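(* The isomorphism relation for countable linear orders is Borel reducible to the conjugacy relation on $\mathrm{Aut}(\infty\mathbin{\hat{*}} I_\infty)$. Hence the conjugacy relation on $\mathrm{Aut}(\infty\mathbin{\hat{*}} I_\infty)$ is Borel complete.
   Context: A digraph is a set with an irreflexive asymmetric edge relation $\to$; $x\perp y$ means no edge between $x,y$. A digraph is complete multipartite if $\perp$ (taken reflexively) is an equivalence relation; its classes are the maximal antichains. Let $\mathcal C$ be the class of finite complete multipartite digraphs with the parity property: for every two distinct maximal antichains $A,B$, distinct $a,a'\in A$ and distinct $b,b'\in B$, there is an even number of edges pointing from $\{a,a'\}$ to $\{b,b'\}$. $\mathcal C$ is an amalgamation class, and $\infty\mathbin{\hat{*}} I_\infty$ denotes its Fraïssé limit (the semigeneric complete multipartite digraph), a countable homogeneous digraph. $\mathrm{Aut}(\infty\mathbin{\hat{*}} I_\infty)$ is a Polish group; conjugacy: $\phi\sim\psi$ iff $\alpha\phi\alpha^{-1}=\psi$ for some automorphism $\alpha$. Borel reducibility: $E\le_B F$ if there is a Borel $f$ with $x\mathrel{E}x'\iff f(x)\mathrel{F}f(x')$. Borel complete: reducible to the isomorphism relation on some class of countable structures (coded on $\mathbb N$), and the isomorphism relation on every class of countable structures is Borel reducible to it. *)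

(* Defs.v *)
From HB Require Import structures.
From mathcomp Require Import all_boot all_order.
From mathcomp Require Import boolp classical_sets measurable_structure.
Set Implicit Arguments. Unset Strict Implicit. Unset Printing Implicit Defensive.
Local Open Scope classical_set_scope.

(* Borel reducibility of E (on X, a subset of a coding space S whose Borel
   sigma-algebra is generated by GS) to F (on Y, a subset of U, generated
   by GU). The reducing map is Borel w.r.t. the relative sigma-algebras. *)
Definition borel_reducible {S U : Type}
  (GS : set (set S)) (X : set S) (E : S -> S -> Prop)
  (GU : set (set U)) (Y : set U) (F : U -> U -> Prop) : Prop :=
  exists f : S -> U,
    (forall x, X x -> Y (f x)) /\
    (forall B, <<s GU >> B ->
       exists C, <<s GS >> C /\ X `&` (f @^-1` B) = X `&` C) /\
    (forall x y, X x -> X y -> (E x y <-> F (f x) (f y))).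

Definition baire_gen : set (set (nat -> nat)) :=
  [set A | exists n m : nat, A = [set f | f n = m]].

Definition rel_gen : set (set (nat -> nat -> bool)) :=
  [set A | exists a b : nat, A = [set R : nat -> nat -> bool | R a b]].

(* A countable relational language: a countable set I of symbols with arities.
   An L-structure with universe N is coded as an element of
   prod_{i in I} 2^(N^(ar i)). *)
Definition structure (I : countType) (ar : I -> nat) : Type :=
  forall i : I, (ar i).-tuple nat -> bool.

Definition mod_gen (I : countType) (ar : I -> nat) : set (set (structure ar)) :=
  [set A | exists (i : I) (t : (ar i).-tuple nat), A = [set M : structure ar | M i t]].

Definition iso_struct (I : countType) (ar : I -> nat) (M N : structure ar) : Prop :=
  exists h : nat -> nat, bijective h /\
    forall (i : I) (t : (ar i).-tuple nat), M i t = N i (map_tuple h t).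

Definition is_class (I : countType) (ar : I -> nat) (K : set (structure ar)) : Prop :=
  <<s @mod_gen I ar >> K /\
  (forall M N, iso_struct M N -> K M -> K N).

Definition borel_complete {S : Type} (GS : set (set S)) (X : set S)
  (E : S -> S -> Prop) : Prop :=
  (exists (I : countType) (ar : I -> nat) (K : set (structure ar)),
     is_class K /\ borel_reducible GS X E (@mod_gen I ar) K (@iso_struct I ar)) /\
  (forall (I : countType) (ar : I -> nat) (K : set (structure ar)),
     is_class K -> borel_reducible (@mod_gen I ar) K (@iso_struct I ar) GS X E).

Definition is_LO (R : nat -> nat -> bool) : Prop :=
  (forall x, ~~ R x x) /\
  (forall x y z, R x y -> R y z -> R x z) /\
  (forall x y, x <> y -> R x y || R y x).

Definition iso_LO (R R' : nat -> nat -> bool) : Prop :=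
  exists h : nat -> nat, bijective h /\ forall x y, R x y = R' (h x) (h y).

Definition perp {T : Type} (e : T -> T -> bool) (x y : T) : bool :=
  ~~ e x y && ~~ e y x.

Definition is_digraph {T : Type} (e : T -> T -> bool) : Prop :=
  (forall x, ~~ e x x) /\ (forall x y, e x y -> ~~ e y x).

(* perp (which is reflexive and symmetric for a digraph) is an equivalence *)
Definition complete_multipartite {T : Type} (e : T -> T -> bool) : Prop :=
  is_digraph e /\ (forall x y z, perp e x y -> perp e y z -> perp e x z).

(* parity property: for distinct maximal antichains A, B (i.e. a in A, b in B
   with a, b not perpendicular), distinct a,a' in A, distinct b,b' in B, the
   number of edges from {a,a'} to {b,b'} is even. *)
Definition parity_property {T : Type} (e : T -> T -> bool) : Prop :=
  forall a a' b b', a <> a' -> b <> b' -> perp e a a' -> perp e b b' ->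
    ~~ perp e a b ->
    ~~ odd (e a b + e a b' + e a' b + e a' b').

Definition in_C (T : finType) (e : rel T) : Prop :=
  complete_multipartite e /\ parity_property e.

Definition is_aut (eG : nat -> nat -> bool) (f : nat -> nat) : Prop :=
  bijective f /\ forall x y, eG (f x) (f y) = eG x y.

Definition age_is_C (eG : nat -> nat -> bool) : Prop :=
  (forall (T : finType) (h : T -> nat), injective h ->
     in_C [rel x y : T | eG (h x) (h y)]) /\
  (forall (T : finType) (e : rel T), in_C e ->
     exists h : T -> nat, injective h /\ forall x y, e x y = eG (h x) (h y)).

Definition homogeneous (eG : nat -> nat -> bool) : Prop :=
  forall (s : seq nat) (p : nat -> nat),
    {in s &, injective p} ->
    {in s &, forall x y, eG (p x) (p y) = eG x y} ->
    exists sigma, is_aut eG sigma /\ {in s, forall x, sigma x = p x}.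

(* eG (on universe N) is the Fraisse limit of C, i.e. (a copy of) the
   semigeneric complete multipartite digraph  oo ^* I_oo *)
Definition fraisse_limit_C (eG : nat -> nat -> bool) : Prop :=
  is_digraph eG /\ age_is_C eG /\ homogeneous eG.

Definition aut_conj (eG : nat -> nat -> bool) (phi psi : nat -> nat) : Prop :=
  exists alpha alpha_inv : nat -> nat,
    is_aut eG alpha /\ cancel alpha alpha_inv /\ cancel alpha_inv alpha /\
    forall x, alpha (phi (alpha_inv x)) = psi x.

(* Main.v *)
Require Import Defs.
From mathcomp Require Import all_boot all_order.
From mathcomp Require Import boolp classical_sets measurable_structure.
From HB Require Import structures.
From mathcomp Require Import ssralg ssrnum ssrint zify.
Set Implicit Arguments. Unset Strict Implicit. Unset Printing Implicit Defensive.
Local Open Scope classical_set_scope.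

(** A complete multipartite digraph with the parity property is given, up to a
    tournament on its parts, by letting every part cut every other part into two
    halves; it is semigeneric as soon as this incidence between parts and vertices is
    generic. For a tournament [t] on a countable set [W] we build such a digraph
    functorially, from finite trees with leaves in [W + int]. Adding 1 to the integer
    leaves is an automorphism whose fixed points form exactly a copy of [t]. A
    back-and-forth making least choices carries it to the given Fraisse limit in a Borel
    way, and the fixed points recover [t] from the conjugacy class. A linear order is a
    tournament, which gives the first claim.

    Completeness follows since countable structures reduce to tournaments, by the
    argument of Friedman and Stanley. Colour a generic tournament [Z] by [nat] so that
    every permutation of [nat] lifts to [Z]. Order the tree of finite sequences over [Z]
    lexicographically and replace each node by a block whose initial chain has a length
    coding the atomic diagram of the colours along the node. An isomorphism of these
    tournaments preserves lengths, prefixes and diagrams, so that following a branch gives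
    an isomorphism of the structures. *)

(** * Borel predicates and functions *)

Definition borel_pred {S : Type} (GS : set (set S)) (P : S -> Prop) : Prop :=
  <<s GS >> [set x | P x].

Section BorelPred.
Context {S : Type} (GS : set (set S)).
Notation borel := (borel_pred GS).

Lemma borel_ext (P Q : S -> Prop) :
  (forall x, P x <-> Q x) -> borel P -> borel Q.
Proof. by move=> PQ; rewrite /borel_pred; congr (<<s GS >> _); apply/eq_set => x; apply/propext. Qed.

Lemma borel_not (P : S -> Prop) : borel P -> borel (fun x => ~ P x).
Proof.
move=> bP; have [_ + _] := smallest_sigma_algebra [set: S] GS.
by move/(_ _ bP); congr (<<s GS >> _); rewrite setTD.
Qed.

Lemma borel_const (P : Prop) : borel (fun=> P).
Proof.
have b0 : borel (fun=> False) by have [] := smallest_sigma_algebra [set: S] GS.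
have [p|np] := pselect P; last by apply: borel_ext b0 => x; tauto.
by apply: borel_ext (borel_not b0) => x; tauto.
Qed.

Lemma borel_exists_nat (P : nat -> S -> Prop) :
  (forall n, borel (P n)) -> borel (fun x => exists n, P n x).
Proof.
move=> bP; have [_ _ /(_ (fun n => [set x | P n x]))] := smallest_sigma_algebra [set: S] GS.
move=> /(_ bP); congr (<<s GS >> _); apply/seteqP; split=> x /=.
  by case=> n _ Pn; exists n.
by case=> n Pn; exists n.
Qed.

Lemma borel_exists (T : countType) (P : T -> S -> Prop) :
  (forall t, borel (P t)) -> borel (fun x => exists t, P t x).
Proof.
move=> bP.
have := @borel_exists_nat (fun n x => if unpickle n is Some t then P t x else False).
move=> H; apply: borel_ext (H _) => [x|n]; last first.
  by case: (unpickle n) => [t|]; [exact: bP|exact: borel_const].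
split=> [[n]|[t Pt]]; first by case: (unpickle n) => // t Pt; exists t.
by exists (pickle t); rewrite pickleK.
Qed.

Lemma borel_forall (T : countType) (P : T -> S -> Prop) :
  (forall t, borel (P t)) -> borel (fun x => forall t, P t x).
Proof.
move=> bP; apply: borel_ext (borel_not (borel_exists (fun t => borel_not (bP t)))).
move=> x; split=> [nP t|aP [t]]; last by apply.
by apply: contrapT => nPt; apply: nP; exists t.
Qed.

Lemma borel_and (P Q : S -> Prop) :
  borel P -> borel Q -> borel (fun x => P x /\ Q x).
Proof.
move=> bP bQ.
have H : forall b : bool, borel (if b then P else Q) by case.
apply: borel_ext (borel_forall H) => x.
by split=> [a|[Px Qx] []]; [split; [exact: (a true)|exact: (a false)]|..].
Qed.

Lemma borel_impl (P : Prop) (Q : S -> Prop) :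
  (P -> borel Q) -> borel (fun x => P -> Q x).
Proof.
move=> bQ; have [p|np] := pselect P.
  by apply: borel_ext (bQ p) => x; split=> [//|]; apply.
by apply: borel_ext (borel_const True) => x; tauto.
Qed.

(** Measurability for the discrete sigma-algebra, meant for countable [T], where preimages of points
    suffice. *)
Definition borel_fun {T : Type} (f : S -> T) : Prop :=
  forall P : T -> Prop, borel (fun x => P (f x)).

Lemma borel_fun_pointwise (T : countType) (f : S -> T) :
  (forall t, borel (fun x => f x = t)) -> borel_fun f.
Proof.
move=> bf P.
apply: borel_ext (borel_exists (fun t => borel_and (bf t) (borel_const (P t)))).
by move=> x; split=> [[t [-> //]]|Pfx]; exists (f x).
Qed.

Lemma borel_fun_bool (f : S -> bool) : borel (fun x => f x) -> borel_fun f.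
Proof.
move=> bf; apply: borel_fun_pointwise => -[//|].
apply: borel_ext (borel_not bf) => x; split=> [/negP/negbTE//|->//].
Qed.

Lemma borel_fun_const (T : Type) (t : T) : borel_fun (fun=> t).
Proof. by move=> P; exact: borel_const. Qed.

Lemma borel_fun_comp (T U : Type) (g : T -> U) (f : S -> T) :
  borel_fun f -> borel_fun (fun x => g (f x)).
Proof. by move=> bf P; exact: (bf (fun t => P (g t))). Qed.

Lemma borel_fun_bind (T : countType) (U : Type) (f : S -> T) (g : T -> S -> U) :
  borel_fun f -> (forall t, borel_fun (g t)) -> borel_fun (fun x => g (f x) x).
Proof.
move=> bf bg P.
apply: borel_ext (borel_exists (fun t => borel_and (bf (eq^~ t)) (bg t P))) => x.
by split=> [[t [<- //]]|Px]; exists (f x).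
Qed.

Lemma borel_fun_map (A : Type) (T : countType) (f : A -> S -> T) (l : seq A) :
  (forall a, borel_fun (f a)) -> borel_fun (fun x => [seq f a x | a <- l]).
Proof.
move=> bf; elim: l => [|a l IHl] /=; first exact: borel_fun_const.
apply: (borel_fun_bind (g := fun t x => t :: [seq f a x | a <- l])) => // t.
exact: borel_fun_comp IHl.
Qed.

(* The element of least code satisfying P; minimality is what keeps the choice
   Borel in parameters. *)
Definition least_in {T : countType} (P : T -> Prop) (t : T) : Prop :=
  P t /\ forall u, (pickle u < pickle t)%N -> ~ P u.

Definition least {T : countType} (P : T -> Prop) : option T :=
  if pselect (exists t, `[< least_in P t >]) is left H then Some (xchoose H) else None.

Lemma least_uniq (T : countType) (P : T -> Prop) t u :
  least_in P t -> least_in P u -> t = u.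
Proof.
move=> [Pt mt] [Pu mu]; case: (ltngtP (pickle t) (pickle u)).
- by move/mu.
- by move/mt.
- exact: (pcan_inj pickleK).
Qed.

Lemma leastE (T : countType) (P : T -> Prop) t : least P = Some t <-> least_in P t.
Proof.
rewrite /least; case: pselect => [H|nH]; last first.
  by split=> // lt; case: nH; exists t; apply/asboolP.
have /asboolP lH := xchooseP H; split=> [[<-] //|lt].
by congr Some; exact: least_uniq lH lt.
Qed.

Lemma least_ex (T : countType) (P : T -> Prop) :
  (exists t, P t) -> exists2 t, least P = Some t & P t.
Proof.
case=> t Pt; have exn : exists n, `[< exists u : T, P u /\ pickle u = n >].
  by exists (pickle t); apply/asboolP; exists t.
case: (ex_minnP exn) => n /asboolP [u [Pu un]] min_n.
exists u => //; apply/leastE; split=> // v; rewrite un => vn Pv.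
by move: vn; rewrite ltnNge min_n //; apply/asboolP; exists v.
Qed.

Lemma borel_fun_least (T : countType) (P : T -> S -> Prop) :
  (forall t, borel (P t)) -> borel_fun (fun x => least (P^~ x)).
Proof.
move=> bP.
have bL t : borel (fun x => least (P^~ x) = Some t).
  apply: (@borel_ext (fun x => P t x /\
    forall u : T, (pickle u < pickle t)%N -> ~ P u x)).
    by move=> x; rewrite leastE.
  apply: borel_and => //; apply: borel_forall => u; apply: borel_impl => _.
  exact: borel_not.
apply: borel_fun_pointwise => -[t|]; first exact: bL.
apply: borel_ext (borel_not (borel_exists bL)) => x; split=> [|->]; last by move=> [t].
by case: (least _) => // t []; exists t.
Qed.

End BorelPred.

(** The sets with Borel preimage form a sigma-algebra, so generators suffice. *)
Lemma borel_pred_preimage (S U : Type) (GS : set (set S)) (GU : set (set U)) (f : S -> U) :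
  (forall B, GU B -> borel_pred GS (fun x => B (f x))) ->
  forall B, <<s GU >> B -> <<s GS >> (f @^-1` B).
Proof.
move=> bG; apply: (@smallest_sub _ (sigma_algebra [set: U]) GU
   [set B | <<s GS >> (f @^-1` B)]); last by move=> B /bG.
split=> /=.
- by rewrite preimage_set0; case: (smallest_sigma_algebra [set: S] GS).
- move=> B bB; rewrite setTD; exact: (borel_not bB).
- move=> B bB; rewrite preimage_bigcup.
  by have [_ _ ] := smallest_sigma_algebra [set: S] GS; apply.
Qed.

Lemma borel_reducible_intro (S U : Type) (GS : set (set S)) (X : set S) (E : S -> S -> Prop)
    (GU : set (set U)) (Y : set U) (F : U -> U -> Prop) (f : S -> U) :
  (forall x, X x -> Y (f x)) ->
  (forall B, GU B -> borel_pred GS (fun x => B (f x))) ->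
  (forall x y, X x -> X y -> (E x y <-> F (f x) (f y))) ->
  borel_reducible GS X E GU Y F.
Proof.
move=> fXY bf fE; exists f; split=> //; split=> // B bB.
by exists (f @^-1` B); split=> //; apply: borel_pred_preimage bB.
Qed.

(** * Back and forth *)

Section BackForth.
Context {S : Type} (GS : set (set S)) (X : set S) {A B : countType} (a0 : A) (b0 : B).
Variable PI : S -> seq (A * B) -> Prop.

(** Off [X] an extension may fail to exist; the list is then kept, so that the stages are total and
    Borel on all of [S]. *)
Definition push_l (a : A) (s : seq (A * B)) (x : S) : seq (A * B) :=
  if least (fun b => PI x ((a, b) :: s)) is Some b then (a, b) :: s else s.

Definition push_r (b : B) (s : seq (A * B)) (x : S) : seq (A * B) :=
  if least (fun a => PI x ((a, b) :: s)) is Some a then (a, b) :: s else s.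

Fixpoint stage (n : nat) (x : S) : seq (A * B) :=
  if n is m.+1 then
    (fun s => if unpickle m is Some b then push_r b s x else s)
      (if unpickle m is Some a then push_l a (stage m x) x else stage m x)
  else [::].

Definition limit_rel (x : S) (a : A) (b : B) : Prop := exists n, (a, b) \in stage n x.

Definition limit_fun (x : S) (a : A) : B := odflt b0 (least (limit_rel x a)).

Hypothesis PI_borel : forall s, borel_pred GS (PI^~ s).
Hypothesis PI_nil : forall x, X x -> PI x [::].
Hypothesis PI_forth : forall x s a, X x -> PI x s -> exists b, PI x ((a, b) :: s).
Hypothesis PI_back : forall x s b, X x -> PI x s -> exists a, PI x ((a, b) :: s).
Hypothesis PI_inj : forall x s p q, X x -> PI x s -> p \in s -> q \in s ->
  (p.1 == q.1) = (p.2 == q.2).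

Lemma borel_fun_push_l a s : borel_fun GS (push_l a s).
Proof.
apply: (borel_fun_comp (fun o => if o is Some b then (a, b) :: s else s)).
exact: borel_fun_least.
Qed.

Lemma borel_fun_push_r b s : borel_fun GS (push_r b s).
Proof.
apply: (borel_fun_comp (fun o => if o is Some a then (a, b) :: s else s)).
exact: borel_fun_least.
Qed.

Lemma borel_fun_stage n : borel_fun GS (stage n).
Proof.
elim: n => [|n IHn] /=; first exact: borel_fun_const.
apply: (borel_fun_bind (g := fun s x => if unpickle n is Some b then push_r b s x else s)).
  case: (unpickle n) => [a|//].
  exact: (borel_fun_bind (g := push_l a) IHn (borel_fun_push_l a)).
move=> s; case: (unpickle n) => [b|]; first exact: borel_fun_push_r.
exact: borel_fun_const.
Qed.

Lemma borel_fun_limit a : borel_fun GS (limit_fun^~ a).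
Proof.
apply: (borel_fun_comp (odflt b0)); apply: borel_fun_least => b.
apply: borel_exists_nat => n.
exact: (borel_fun_stage n (fun s => (a, b) \in s)).
Qed.

Lemma push_lP a s x : X x -> PI x s ->
  [/\ PI x (push_l a s x), {subset s <= push_l a s x} &
      exists b, (a, b) \in push_l a s x].
Proof.
move=> Xx Ps; rewrite /push_l.
have [b -> Pb] := least_ex (PI_forth a Xx Ps).
by split=> // [p ps|]; [rewrite in_cons ps orbT|exists b; exact: mem_head].
Qed.

Lemma push_rP b s x : X x -> PI x s ->
  [/\ PI x (push_r b s x), {subset s <= push_r b s x} &
      exists a, (a, b) \in push_r b s x].
Proof.
move=> Xx Ps; rewrite /push_r.
have [a -> Pa] := least_ex (PI_back b Xx Ps).
by split=> // [p ps|]; [rewrite in_cons ps orbT|exists a; exact: mem_head].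
Qed.

Lemma stageS n x : X x -> PI x (stage n x) ->
  [/\ PI x (stage n.+1 x), {subset stage n x <= stage n.+1 x},
      forall a, unpickle n = Some a -> exists b, (a, b) \in stage n.+1 x &
      forall b, unpickle n = Some b -> exists a, (a, b) \in stage n.+1 x].
Proof.
move=> Xx Pn /=.
set s := (if unpickle n is Some a then push_l a (stage n x) x else stage n x).
have [Ps sub_s in_s] : [/\ PI x s, {subset stage n x <= s} &
    forall a, unpickle n = Some a -> exists b, (a, b) \in s].
  rewrite /s; case: (@unpickle A n) => [a|]; last by split.
  by have [? ? ab] := push_lP a Xx Pn; split=> // _ [<-].
case: (@unpickle B n) => [b|]; last by split.
have [Ps' sub' ab] := push_rP b Xx Ps.
split=> // [p /sub_s/sub'//|a /in_s[c /sub' cs]|_ [<-] //].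
by exists c.
Qed.

Lemma stage_PI n x : X x -> PI x (stage n x).
Proof.
move=> Xx; elim: n => [|n IHn]; first exact: PI_nil.
by have [] := stageS Xx IHn.
Qed.

Lemma stage_le m n x : X x -> (m <= n)%N -> {subset stage m x <= stage n x}.
Proof.
move=> Xx; elim: n => [|n IHn]; first by rewrite leqn0 => /eqP->.
rewrite leq_eqVlt => /predU1P[->//|]; rewrite ltnS => /IHn sub p /sub.
by have [_ + _ _] := stageS Xx (stage_PI n Xx); apply.
Qed.

Lemma limit_rel_inj x a b a' b' : X x -> limit_rel x a b -> limit_rel x a' b' ->
  (a == a') = (b == b').
Proof.
move=> Xx [m ma] [n na].
have sm := stage_le Xx (leq_maxl m n) ma; have sn := stage_le Xx (leq_maxr m n) na.
exact: (PI_inj Xx (stage_PI _ Xx) sm sn).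
Qed.

Lemma limit_funP x a : X x -> limit_rel x a (limit_fun x a).
Proof.
move=> Xx; rewrite /limit_fun.
have [_ _ /(_ a (pickleK a))[b ab] _] := stageS Xx (stage_PI (pickle a) Xx).
have : exists b, limit_rel x a b by exists b, (pickle a).+1.
by move=> /least_ex[c -> ].
Qed.

Lemma limit_fun_surj x b : X x -> exists a, limit_fun x a = b.
Proof.
move=> Xx; have [_ _ _ /(_ b (pickleK b))[a ab]] := stageS Xx (stage_PI (pickle b) Xx).
exists a; apply/eqP; rewrite -(@limit_rel_inj x a _ a) //; first exact: limit_funP.
by exists (pickle b).+1.
Qed.

Definition limit_inv (x : S) (b : B) : A :=
  odflt a0 (least (fun a => limit_fun x a = b)).

Lemma borel_fun_limit_inv b : borel_fun GS (limit_inv^~ b).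
Proof.
apply: (borel_fun_comp (odflt a0)); apply: borel_fun_least => a.
exact: (borel_fun_limit a (eq^~ b)).
Qed.

Lemma limit_invK x : X x -> cancel (limit_inv x) (limit_fun x).
Proof.
move=> Xx b; rewrite /limit_inv.
by have [a -> ] := least_ex (limit_fun_surj b Xx).
Qed.

Lemma limit_funK x : X x -> cancel (limit_fun x) (limit_inv x).
Proof.
move=> Xx a; apply/eqP; have fP c := limit_funP c Xx.
by rewrite (limit_rel_inj Xx (fP _) (fP _)) limit_invK.
Qed.

Lemma limit_fun_seq x (l : seq A) : X x ->
  exists s, PI x s /\ {in l, forall a, (a, limit_fun x a) \in s}.
Proof.
move=> Xx; suff [n nP] : exists n, {in l, forall a, (a, limit_fun x a) \in stage n x}.
  by exists (stage n x); split=> //; exact: stage_PI.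
elim: l => [|a l [n IHl]]; first by exists 0.
have [m am] := limit_funP a Xx; exists (maxn m n) => c.
rewrite in_cons => /predU1P[->|cl].
  exact: stage_le (leq_maxl m n) _ am.
exact: stage_le (leq_maxr m n) _ (IHl c cl).
Qed.

End BackForth.

(** The last clause puts every finite piece of [g x] inside one member of [PI x], through which
    properties of [PI] pass to [g x]. *)
Lemma borel_back_and_forth (S : Type) (GS : set (set S)) (X : set S) (A B : countType)
    (a0 : A) (b0 : B) (PI : S -> seq (A * B) -> Prop) :
  (forall s, borel_pred GS (PI^~ s)) ->
  (forall x, X x -> PI x [::]) ->
  (forall x s a, X x -> PI x s -> exists b, PI x ((a, b) :: s)) ->
  (forall x s b, X x -> PI x s -> exists a, PI x ((a, b) :: s)) ->
  (forall x s p q, X x -> PI x s -> p \in s -> q \in s -> (p.1 == q.1) = (p.2 == q.2)) ->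
  exists (g : S -> A -> B) (g' : S -> B -> A),
    [/\ forall a, borel_fun GS (g^~ a), forall b, borel_fun GS (g'^~ b) &
      forall x, X x -> [/\ cancel (g x) (g' x), cancel (g' x) (g x) &
        forall l : seq A, exists s, PI x s /\ {in l, forall a, (a, g x a) \in s}]].
Proof.
move=> PIb PI0 PIf PIr PIi; exists (limit_fun b0 PI), (limit_inv a0 b0 PI).
split=> [a|b|x Xx]; [exact: borel_fun_limit|exact: borel_fun_limit_inv|split].
- exact: (@limit_funK _ X).
- exact: (@limit_invK _ X).
- by move=> l; exact: (@limit_fun_seq _ X).
Qed.

Lemma back_and_forth (A B : countType) (a0 : A) (b0 : B) (PI : seq (A * B) -> Prop) :
  PI [::] ->
  (forall s a, PI s -> exists b, PI ((a, b) :: s)) ->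
  (forall s b, PI s -> exists a, PI ((a, b) :: s)) ->
  (forall s p q, PI s -> p \in s -> q \in s -> (p.1 == q.1) = (p.2 == q.2)) ->
  exists2 g : A -> B, bijective g &
    forall l : seq A, exists s, PI s /\ {in l, forall a, (a, g a) \in s}.
Proof.
move=> PI0 PIf PIr PIi.
(* On a one-point parameter space generated by all its subsets the Borel requirement is trivial. *)
have [|||||g [g' [_ _ /(_ tt Logic.I)[gK g'K gl]]]] :=
  @borel_back_and_forth unit setT setT A B a0 b0 (fun=> PI).
- by move=> s; exact: sub_gen_smallest.
- by [].
- by move=> _ s a _; exact: PIf.
- by move=> _ s b _; exact: PIr.
- by move=> _ s p q _; exact: PIi.
by exists (g tt) => //; exists (g' tt).
Qed.

(** * Partial isomorphisms and the extension property *)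

Definition tournament {W : eqType} (t : rel W) : Prop :=
  (forall x, ~~ t x x) /\ (forall x y, x != y -> t x y = ~~ t y x).

Lemma fresh_index (T : eqType) (g : nat -> T) (l : seq T) :
  injective g -> exists n, g n \notin l.
Proof.
move=> g_inj; apply: contrapT => nH.
have sub : {subset map g (iota 0 (size l).+1) <= l}.
  by move=> _ /mapP[n _ ->]; apply: contrapT => /negP gn; apply: nH; exists n.
have := uniq_leq_size _ sub; rewrite map_inj_uniq // iota_uniq size_map size_iota.
by rewrite ltnn => /(_ isT).
Qed.

Definition partial_iso {A B : eqType} (e1 : A -> A -> bool) (e2 : B -> B -> bool)
    (s : seq (A * B)) : Prop :=
  forall p q, p \in s -> q \in s -> (p.1 == q.1) = (p.2 == q.2) /\ e1 p.1 q.1 = e2 p.2 q.2.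

Lemma partial_iso_cons (A B : eqType) (e1 : A -> A -> bool) (e2 : B -> B -> bool)
    (s : seq (A * B)) a b :
  partial_iso e1 e2 s -> e1 a a = e2 b b ->
  (forall p, p \in s ->
     [/\ (a == p.1) = (b == p.2), e1 a p.1 = e2 b p.2 & e1 p.1 a = e2 p.2 b]) ->
  partial_iso e1 e2 ((a, b) :: s).
Proof.
move=> sP abE ab p q; rewrite !in_cons => /predU1P[->|ps] /predU1P[->|qs] /=.
- by rewrite !eqxx.
- by have [] := ab q qs.
- by have [E _ ?] := ab p ps; rewrite eq_sym E eq_sym.
- exact: sP.
Qed.

Lemma partial_iso_mem (A B : eqType) (e1 : A -> A -> bool) (e2 : B -> B -> bool)
    (s : seq (A * B)) p :
  partial_iso e1 e2 s -> p \in s -> partial_iso e1 e2 ((p.1, p.2) :: s).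
Proof.
move=> sP ps q r; rewrite -surjective_pairing !in_cons.
by move=> /predU1P[->|qs] /predU1P[->|rs]; apply: sP.
Qed.

Lemma partial_iso_swap (A B : eqType) (e1 : A -> A -> bool) (e2 : B -> B -> bool)
    (s : seq (A * B)) :
  partial_iso e1 e2 s -> partial_iso e2 e1 [seq (p.2, p.1) | p <- s].
Proof. by move=> sP _ _ /mapP[p ps ->] /mapP[q qs ->]; have [-> ->] := sP p q ps qs. Qed.

(** With [A] arbitrary, this drives both directions of the back-and-forth: [B] is the Fraisse limit
    in one and the tree digraph in the other. *)
Definition has_extensions {B : eqType} (e2 : B -> B -> bool) : Prop :=
  forall (A : choiceType) (e1 : A -> A -> bool) (s : seq (A * B)) (a : A),
    complete_multipartite e1 -> parity_property e1 -> partial_iso e1 e2 s ->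
    exists b, partial_iso e1 e2 ((a, b) :: s).

Lemma in_C_sub (A : Type) (e : A -> A -> bool) (T : finType) (h : T -> A) :
  injective h -> complete_multipartite e -> parity_property e ->
  in_C [rel x y : T | e (h x) (h y)].
Proof.
move=> h_inj [[irr asym] tr] par; split.
  split; first by split=> [x|x y]; [exact: irr|exact: asym].
  by move=> x y z; exact: tr.
move=> a a' b b' aa' bb'; apply: par; first by move/h_inj.
by move/h_inj.
Qed.

(** Each axiom involves at most four vertices, so it is tested in a finite induced subdigraph. *)
Lemma age_complete_multipartite eG : is_digraph eG -> age_is_C eG ->
  complete_multipartite eG /\ parity_property eG.
Proof.
move=> digr [sub _]; split.
  split=> // x y z.
  have [[_ tr] _] := sub _ (fun t : seq_sub [:: x; y; z] => ssval t) val_inj.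
  have xP : x \in [:: x; y; z] by rewrite !inE eqxx.
  have yP : y \in [:: x; y; z] by rewrite !inE eqxx ?orbT.
  have zP : z \in [:: x; y; z] by rewrite !inE eqxx ?orbT.
  exact: (tr (SeqSub xP) (SeqSub yP) (SeqSub zP)).
move=> a a' b b' aa' bb'.
have [_ par] := sub _ (fun t : seq_sub [:: a; a'; b; b'] => ssval t) val_inj.
have aP : a \in [:: a; a'; b; b'] by rewrite !inE eqxx.
have a'P : a' \in [:: a; a'; b; b'] by rewrite !inE eqxx ?orbT.
have bP : b \in [:: a; a'; b; b'] by rewrite !inE eqxx ?orbT.
have b'P : b' \in [:: a; a'; b; b'] by rewrite !inE eqxx ?orbT.
by apply: (par (SeqSub aP) (SeqSub a'P) (SeqSub bP) (SeqSub b'P)) => -[].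
Qed.

(** Universality embeds [a] with the domain of [s]; homogeneity then moves the copy of that domain
    onto the range of [s], and the copy of [a] is carried along. *)
Lemma fraisse_limit_extensions eG : fraisse_limit_C eG -> has_extensions eG.
Proof.
move=> [digr [[_ univ] homog]] A e1 s a e1cm e1par sP.
pose l := a :: map fst s.
have [h [h_inj hE]] := univ _ _
  (in_C_sub (h := fun t : seq_sub l => ssval t) val_inj e1cm e1par).
pose hh x := if insub x is Some t then h t else 0.
have hhE x (xl : x \in l) : hh x = h (SeqSub xl).
  rewrite /hh; case: insubP => [t _ tx|]; last by rewrite xl.
  by congr h; apply: val_inj.
have hh_inj : {in l &, injective hh}.
  by move=> x y xl yl; rewrite !hhE => /h_inj[].
have hh_e : {in l &, forall x y, eG (hh x) (hh y) = e1 x y}.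
  by move=> x y xl yl; rewrite !hhE -hE.
have sl p : p \in s -> p.1 \in l by move=> ps; rewrite in_cons map_f ?orbT.
(* The finite map given to homogeneity: it decodes a vertex of the copy and sends it through [s]. *)
pose f n := (nth (a, 0) s (find (fun p => hh p.1 == n) s)).2.
have fE p : p \in s -> f (hh p.1) = p.2.
  move=> ps; have hs : has (fun q => hh q.1 == hh p.1) s by apply/hasP; exists p.
  have qs := hs; rewrite has_find in qs; have := nth_find (a, 0) hs.
  set q := nth _ _ _ => /eqP; have {}qs : q \in s by exact: mem_nth.
  move=> /hh_inj-/(_ (sl _ qs) (sl _ ps))/eqP.
  by have [-> _] := sP q p qs ps => /eqP.
have [||sigma [[sg_bij sg_e] sgf]] := homog [seq hh p.1 | p <- s] f.
- move=> _ _ /mapP[p ps ->] /mapP[q qs ->]; rewrite !fE // => /eqP.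
  by have [<- _] := sP p q ps qs => /eqP->.
- move=> _ _ /mapP[p ps ->] /mapP[q qs ->]; rewrite !fE //.
  by have [_ <-] := sP p q ps qs; rewrite hh_e // sl.
have al : a \in l by exact: mem_head.
exists (sigma (hh a)); apply: partial_iso_cons => //.
  by rewrite sg_e hh_e.
move=> p ps; have <- : sigma (hh p.1) = p.2.
  by rewrite sgf ?fE //; apply/mapP; exists p.
rewrite !sg_e !hh_e ?sl //; split=> //.
rewrite (bij_eq sg_bij); apply/eqP/eqP => [->//|].
by apply: hh_inj => //; exact: sl.
Qed.

(** * A functorial semigeneric digraph over a tournament *)

Inductive btree (A : Type) := BLeaf of A | BNode of btree A & btree A.
Arguments BLeaf {A}.

Fixpoint btree_encode {A : Type} (t : btree A) : GenTree.tree A :=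
  match t with
  | BLeaf a => GenTree.Leaf a
  | BNode u v => GenTree.Node 0 [:: btree_encode u; btree_encode v]
  end.

Fixpoint btree_decode {A : Type} (t : GenTree.tree A) : option (btree A) :=
  match t with
  | GenTree.Leaf a => Some (BLeaf a)
  | GenTree.Node _ [:: u; v] =>
      if (btree_decode u, btree_decode v) is (Some u', Some v') then Some (BNode u' v')
      else None
  | _ => None
  end.

Lemma btree_encodeK (A : Type) : pcancel (@btree_encode A) btree_decode.
Proof. by elim=> //= u -> v ->. Qed.

HB.instance Definition _ (A : countType) :=
  Countable.copy (btree A) (pcan_type (@btree_encodeK A)).

Section TreeOps.
Context {A : countType}.
Implicit Types t u : btree A.

(** The right spine is read as a list, so a tree behaves like a hereditarily finite set. *)
Fixpoint children t : seq (btree A) := if t is BNode u v then u :: children v else [::].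

Definition of_children (a : A) (l : seq (btree A)) : btree A := foldr (@BNode A) (BLeaf a) l.

Lemma of_childrenK a l : children (of_children a l) = l.
Proof. by elim: l => //= u l ->. Qed.

Definition head_tree t : btree A := if t is BNode u _ then u else t.

(** A lexicographic comparison; over a tournament on the leaves it is again a tournament, in general
    not transitive. *)
Fixpoint tree_lt (r : rel A) t u : bool :=
  match t, u with
  | BLeaf a, BLeaf b => r a b
  | BLeaf _, BNode _ _ => true
  | BNode _ _, BLeaf _ => false
  | BNode t1 t2, BNode u1 u2 => if t1 == u1 then tree_lt r t2 u2 else tree_lt r t1 u1
  end.

Lemma BNode_eq (t1 t2 u1 u2 : btree A) :
  (BNode t1 t2 == BNode u1 u2) = (t1 == u1) && (t2 == u2).
Proof. by apply/eqP/andP => [[-> ->]|[/eqP-> /eqP->]]. Qed.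

Lemma BLeaf_eq (a b : A) : (BLeaf a == BLeaf b) = (a == b).
Proof. by apply/eqP/eqP => [[]|->]. Qed.

Lemma tree_lt_tournament r : tournament r -> tournament (tree_lt r).
Proof.
move=> [irr tot]; split; first by elim=> //= u _ v; rewrite eqxx.
elim=> [a|t1 IH1 t2 IH2] [b|u1 u2] //=; first by rewrite BLeaf_eq; exact: tot.
rewrite BNode_eq (eq_sym u1); case: eqVneq => //= [_|ne _]; first exact: IH2.
exact: IH1.
Qed.

(** The left subtree alone decides, so the right one can be chosen once the comparison is known.
    This breaks a circularity in [extension_new_part]. *)
Lemma tree_lt_head r t u v v' : t != head_tree u ->
  tree_lt r (BNode t v) u = tree_lt r (BNode t v') u.
Proof. by case: u => //= u1 u2 /negbTE->. Qed.

Lemma borel_tree_lt (S : Type) (GS : set (set S)) (r : S -> rel A) t u :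
  (forall a b, borel_fun GS (fun x => r x a b)) ->
  borel_fun GS (fun x => tree_lt (r x) t u).
Proof.
move=> br; elim: t u => [a|t1 IH1 t2 IH2] [b|u1 u2] //=; try exact: borel_fun_const.
by case: eqP.
Qed.

End TreeOps.

Fixpoint tree_map {A B : Type} (f : A -> B) (t : btree A) : btree B :=
  match t with
  | BLeaf a => BLeaf (f a)
  | BNode u v => BNode (tree_map f u) (tree_map f v)
  end.

Lemma tree_map_inj (A B : Type) (f : A -> B) : injective f -> injective (tree_map f).
Proof.
move=> f_inj; elim=> [a|t1 IH1 t2 IH2] [b|u1 u2] //=; first by case=> /f_inj->.
by case=> /IH1-> /IH2->.
Qed.

Lemma tree_map_comp (A B C : Type) (f : B -> C) (g : A -> B) t :
  tree_map f (tree_map g t) = tree_map (f \o g) t.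
Proof. by elim: t => //= t -> u ->. Qed.

Lemma tree_map_id (A : Type) (f : A -> A) t : f =1 id -> tree_map f t = t.
Proof. by move=> fid; elim: t => /= [a|t -> u -> //]; rewrite fid. Qed.

Lemma eq_tree_map (A B : Type) (f g : A -> B) : f =1 g -> tree_map f =1 tree_map g.
Proof. by move=> fg; elim=> /= [a|t -> u -> //]; rewrite fg. Qed.

Lemma children_map (A B : countType) (f : A -> B) t :
  children (tree_map f t) = map (tree_map f) (children t).
Proof. by elim: t => //= t _ u ->. Qed.

Lemma tree_lt_map (A B : countType) (f : A -> B) (r : rel A) (r' : rel B) t u :
  injective f -> (forall a b, r' (f a) (f b) = r a b) ->
  tree_lt r' (tree_map f t) (tree_map f u) = tree_lt r t u.
Proof.
move=> f_inj rE; elim: t u => [a|t1 IH1 t2 IH2] [b|u1 u2] //=.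
by rewrite (inj_eq (tree_map_inj f_inj)) IH1 IH2.
Qed.

(** * The semigeneric digraph of a tournament *)

Section Semigeneric.
Context {W : countType}.

Definition atom : countType := (W + int)%type.
Notation tree := (btree atom).

(* [inl w] is the only named vertex of the part [BLeaf (inl w)];
   [inr (p, k, u)] lies in the part [p]. *)
Definition vertex : countType := (W + tree * int * tree)%type.
Implicit Types v w : vertex.

Definition part v : tree :=
  match v with inl w => BLeaf (inl w) | inr (p, _, _) => p end.

(** Vertices become trees, so that a part, itself a tree, can have vertices among its children. *)
Definition vcode v : tree :=
  match v with inl w => BLeaf (inl w) | inr (p, k, u) => BNode (BNode p (BLeaf (inr k))) u end.

Definition listed v : seq tree := if v is inr (_, _, u) then children u else [::].

(* Each part [q] cuts the vertices in two halves. Membership one way or the other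
   makes the incidence between parts and vertices generic, as in the model of the
   random graph on the hereditarily finite sets. *)
Definition half (q : tree) v : bool := (vcode v \in children q) || (q \in listed v).

(** The integers keep their usual order, which translation preserves; this makes [shift] an
    automorphism. *)
Definition atom_lt (t : rel W) (a b : atom) : bool :=
  match a, b with
  | inl x, inl y => t x y
  | inl _, inr _ => true
  | inr _, inl _ => false
  | inr j, inr k => (j < k)%R
  end.

Definition sg_edge (t : rel W) v w : bool :=
  (part v != part w) &&
  (tree_lt (atom_lt t) (part v) (part w) (+) half (part w) v (+) half (part v) w).

Lemma vcode_inj : injective vcode.
Proof. by move=> [w|[[p k] u]] [w'|[[p' k'] u']] //= []; [move=> ->|move=> -> -> ->]. Qed.

Lemma atom_lt_tournament t : tournament t -> tournament (atom_lt t).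
Proof.
move=> [irr tot]; split=> [[x|j]|[x|j] [y|k]] //=.
- by rewrite Order.POrderTheory.ltxx.
- by move=> ne; apply: tot; apply: contra_neq ne => ->.
- move=> ne; rewrite -Order.TotalTheory.leNgt Order.POrderTheory.lt_neqAle.
  by rewrite (_ : j != k) //; apply: contra_neq ne => ->.
Qed.

(** Leaves have no children and named vertices list no part, so no half reverses an edge between
    named vertices. *)
Lemma sg_edge_inl t x y : tournament t -> sg_edge t (inl x) (inl y) = t x y.
Proof.
move=> [irr _]; rewrite /sg_edge /half /= !addbF BLeaf_eq.
rewrite (_ : (inl x == inl y :> atom) = (x == y)) //.
by case: eqVneq => //= ->; rewrite (negbTE (irr y)).
Qed.

Lemma borel_sg_edge (S : Type) (GS : set (set S)) (t : S -> rel W) v w :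
  (forall x y, borel_fun GS (fun s => t s x y)) ->
  borel_fun GS (fun s => sg_edge (t s) v w).
Proof.
move=> bt.
apply: (borel_fun_comp (fun b => (part v != part w) &&
  (b (+) half (part w) v (+) half (part v) w))).
apply: borel_tree_lt => -[x|j] [y|k] //=; exact: borel_fun_const.
Qed.

Section Generic.
Variable t : rel W.
Hypothesis t_tour : tournament t.
Notation lt := (tree_lt (atom_lt t)).
Notation edge := (sg_edge t).

Lemma part_lt_tournament : tournament lt.
Proof. exact/tree_lt_tournament/atom_lt_tournament. Qed.

Lemma sg_edge_part v w : part v = part w -> edge v w = false.
Proof. by rewrite /sg_edge => ->; rewrite eqxx. Qed.

Lemma sg_edgeE v w : part v != part w ->
  edge v w = lt (part v) (part w) (+) half (part w) v (+) half (part v) w.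
Proof. by rewrite /sg_edge => ->. Qed.

Lemma sg_edge_sym v w : part v != part w -> edge w v = ~~ edge v w.
Proof.
move=> ne; rewrite !sg_edgeE // 1?eq_sym // (part_lt_tournament.2 _ _ ne).
by case: (lt _ _); case: (half _ _); case: (half _ _).
Qed.

Lemma sg_edge_perp v w : perp edge v w = (part v == part w).
Proof.
rewrite /perp; case: eqVneq => [vw|ne]; first by rewrite !sg_edge_part.
by rewrite (sg_edge_sym ne); case: (edge v w).
Qed.

Lemma sg_edge_complete_multipartite : complete_multipartite edge.
Proof.
split; first split=> [v|v w]; first by rewrite sg_edge_part.
- by move=> vw; have /andP[ne _] := vw; rewrite (sg_edge_sym ne) vw.
- by move=> u v w; rewrite !sg_edge_perp => /eqP-> /eqP->.
Qed.

(** Modulo 2 an edge is a term of the two parts plus two terms, each depending on one endpoint and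
    the part of the other. Over the four pairs every term occurs an even number of times. *)
Lemma sg_edge_parity : parity_property edge.
Proof.
move=> a a' b b' _ _; rewrite !sg_edge_perp => /eqP aa' /eqP bb' ab.
rewrite !sg_edgeE -?aa' -?bb' //.
by do 4!case: (half _ _); case: (lt _ _).
Qed.

(** * One-point extensions *)

Section Extension.
Context {A : choiceType} (e1 : A -> A -> bool) (s : seq (A * vertex)) (a : A).
Hypothesis e1_cm : complete_multipartite e1.
Hypothesis e1_par : parity_property e1.
Hypothesis sP : partial_iso e1 edge s.
Hypothesis a_new : a \notin map fst s.

Let e1_irr x : e1 x x = false.
Proof. by apply/negbTE; case: e1_cm => -[]. Qed.

Let e1_sym x y : ~~ perp e1 x y -> e1 x y = ~~ e1 y x.
Proof.
have [[_ asym] _] := e1_cm; rewrite /perp.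
by have := asym x y; case: (e1 x y) => /=; [move=> ->|case: (e1 y x)].
Qed.

Let perpC x y : perp e1 x y = perp e1 y x.
Proof. by rewrite /perp andbC. Qed.

Let perp_s p q : p \in s -> q \in s -> perp e1 p.1 q.1 = (part p.2 == part q.2).
Proof.
move=> ps qs; rewrite -sg_edge_perp /perp.
by have [_ ->] := sP ps qs; have [_ ->] := sP qs ps.
Qed.

Let a_neq p : p \in s -> (a == p.1) = false.
Proof. by move=> ps; apply/eqP => ap; move: a_new; rewrite ap map_f. Qed.

(** The integer [k] is a free parameter: it changes the code of the vertex but neither its part nor
    its list. *)
Lemma fresh_vertex p u : exists k, forall q, q \in s ->
  vcode (inr (p, k, u)) \notin children (part q.2) /\ inr (p, k, u) != q.2 :> vertex.
Proof.
pose l := flatten [seq vcode q.2 :: children (part q.2) | q <- s].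
have [|n] := @fresh_index _ (fun n => vcode (inr (p, Posz n, u))) l.
  by move=> m n /vcode_inj[].
move=> nl; exists (Posz n) => q qs; split.
  apply: contra nl => H; apply/flattenP; exists (vcode q.2 :: children (part q.2)).
    by apply/mapP; exists q.
  by rewrite in_cons H orbT.
apply: contra nl => /eqP->; apply/flattenP; exists (vcode q.2 :: children (part q.2)).
  by apply/mapP; exists q.
exact: mem_head.
Qed.

(** The required edges only say in which half of each other part the new vertex lies. It lists
    exactly the parts whose half must contain it, and a fresh [k] keeps it from being a child of any
    of them. *)
Lemma extension_old_part p0 : p0 \in s -> perp e1 a p0.1 ->
  exists b, partial_iso e1 edge ((a, b) :: s).
Proof.
move=> p0s ap0; pose P := part p0.2.
pose d p := lt P (part p.2) (+) half P p.2 (+) e1 a p.1.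
(* [d p] says whether the new vertex must lie in the half of the part of [p.2]; parity makes the
   answer depend on that part only. *)
have d_part p q : p \in s -> q \in s -> part p.2 = part q.2 -> part p.2 != P -> d p = d q.
  move=> ps qs pq pP; rewrite /d pq.
  have [pq1|/eqP ne] := eqVneq p.1 q.1.
    by have [E _] := sP ps qs; move: E; rewrite pq1 eqxx => /esym/eqP->.
  have np0 : a <> p0.1 by apply/eqP; rewrite a_neq.
  have p0p : part p0.2 != part p.2 by rewrite eq_sym.
  have napP : ~~ perp e1 a p.1.
    apply/negP; rewrite perpC => pa; move: pP; rewrite eq_sym.
    by rewrite -(perp_s p0s ps) perpC (e1_cm.2 _ _ _ pa ap0).
  have := e1_par np0 ne ap0 _ napP; rewrite perp_s // pq eqxx => /(_ isT).
  have [_ ->] := sP p0s ps; have [_ ->] := sP p0s qs.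
  rewrite !sg_edgeE -?pq // -/P.
  by do 3!case: (half _ _); case: (lt _ _); case: (e1 a _); case: (e1 a _).
pose F := [seq part p.2 | p <- s & (part p.2 != P) && d p].
have FE p : p \in s -> part p.2 != P -> (part p.2 \in F) = d p.
  move=> ps pP; apply/mapP/idP => [[q]|dp].
    rewrite mem_filter => /andP[/andP[qP dq] qs] pq.
    by rewrite (d_part p q).
  by exists p => //; rewrite mem_filter pP dp.
have [k kP] := fresh_vertex P (of_children (inr (Posz 0) : atom) F).
pose b : vertex := inr (P, k, of_children (inr (Posz 0) : atom) F).
exists b; apply: partial_iso_cons => //; first by rewrite e1_irr sg_edge_part.
move=> p ps; have [k1 /negbTE k2] := kP p ps; rewrite k2 a_neq //.
have [pP|pP] := eqVneq (part p.2) P.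
  rewrite !sg_edge_part //.
  have : perp e1 a p.1 by apply: (e1_cm.2 _ _ _ ap0); rewrite perp_s // pP.
  by move=> /andP[/negbTE-> /negbTE->].
have nap : ~~ perp e1 a p.1.
  apply/negP; rewrite perpC => pa; move: pP.
  by rewrite -(perp_s ps p0s) (e1_cm.2 _ _ _ pa ap0).
have bp : part b != part p.2 by rewrite eq_sym.
have E : e1 a p.1 = edge b p.2.
  rewrite sg_edgeE //= {1}/half (negbTE k1) /= of_childrenK FE // /d.
  by case: (lt _ _); case: (half _ _); case: (e1 _ _).
split=> //; by rewrite e1_sym 1?perpC // (sg_edge_sym bp) E.
Qed.

(** Dually, the new part receives as children the codes of the vertices its half must contain, and
    the new vertex lists nothing. A fresh leaf [u] as first child keeps the part distinct from all
    parts occurring or listed. *)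
Lemma extension_new_part : (forall p, p \in s -> ~~ perp e1 a p.1) ->
  exists b, partial_iso e1 edge ((a, b) :: s).
Proof.
move=> a_perp.
pose l := flatten [seq head_tree (part p.2) :: map head_tree (listed p.2) | p <- s].
have [|n nl] := @fresh_index _ (fun n => BLeaf (inr (Posz n) : atom)) l.
  by move=> m n [].
pose u : tree := BLeaf (inr (Posz n)); have {}nl : u \notin l by exact: nl.
(* [BNode u u] stands in for the new part [q], whose children depend on [d]: only the head [u]
   matters, by [tree_lt_head]. *)
pose d p := lt (BNode u u) (part p.2) (+) e1 a p.1.
pose F := [seq vcode p.2 | p <- s & d p].
pose q := BNode u (of_children (inr (Posz 0) : atom) F).
have FE p : p \in s -> (vcode p.2 \in F) = d p.
  move=> ps; apply/mapP/idP => [[p']|dp]; last by exists p; rewrite // mem_filter dp.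
  rewrite mem_filter => /andP[dp' p's] /vcode_inj pp'.
  suff -> : p = p' by [].
  have [+ _] := sP ps p's; rewrite pp' eqxx => /eqP; move: pp'.
  by case: p {ps} => ? ?; case: p' {dp' p's} => ? ? /= -> ->.
have u_head p : p \in s -> u != head_tree (part p.2).
  move=> ps; apply: contra nl => /eqP ->; apply/flattenP.
  exists (head_tree (part p.2) :: map head_tree (listed p.2)); last exact: mem_head.
  by apply/mapP; exists p.
have q_listed p : p \in s -> q \notin listed p.2.
  move=> ps; apply: contra nl => ql; apply/flattenP.
  exists (head_tree (part p.2) :: map head_tree (listed p.2)).
    by apply/mapP; exists p.
  by rewrite in_cons (map_f head_tree ql) orbT.
have [k kP] := fresh_vertex q (BLeaf (inr (Posz 0))).
pose b : vertex := inr (q, k, BLeaf (inr (Posz 0))).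
exists b; apply: partial_iso_cons => //; first by rewrite e1_irr sg_edge_part.
move=> p ps; have [k1 /negbTE k2] := kP p ps; rewrite k2 a_neq //.
have bp : part b != part p.2.
  by apply: contraNneq (u_head p ps) => <-.
have nap := a_perp p ps.
have E : e1 a p.1 = edge b p.2.
  have qF : children q = u :: F by rewrite /= of_childrenK.
  rewrite sg_edgeE // (_ : part b = q) // /half (negbTE k1) (negbTE (q_listed p ps)).
  rewrite (_ : listed b = [::]) // in_nil qF in_cons FE // (tree_lt_head _ _ u) ?u_head // /d.
  (* An integer leaf codes no vertex, so the extra child [u] adds nothing to the half. *)
  have -> : (vcode p.2 == u) = false by case: p.2 => [w|[[? ?] ?]].
  by case: (lt _ _); case: (e1 _ _).
split=> //; by rewrite e1_sym 1?perpC // (sg_edge_sym bp) E.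
Qed.

End Extension.

Lemma sg_edge_extensions : has_extensions edge.
Proof.
move=> A e1 s a e1cm e1par sP.
have [/mapP[p ps ->]|a_new] := boolP (a \in map fst s).
  by exists p.2; exact: partial_iso_mem.
have [/hasP[p ps ap]|/hasPn a_perp] := boolP (has (fun p => perp e1 a p.1) s).
  exact: extension_old_part ps ap.
exact: extension_new_part.
Qed.

End Generic.

End Semigeneric.
Arguments atom : clear implicits.
Arguments vertex : clear implicits.

(** * Functoriality in the labels *)

Definition atom_map {W W' : Type} (h : W -> W') (j : int -> int) (a : W + int) : W' + int :=
  match a with inl w => inl (h w) | inr k => inr (j k) end.

Definition vertex_map {W W' : countType} (h : W -> W') (j : int -> int) (v : vertex W) : vertex W' :=
  match v with
  | inl w => inl (h w)
  | inr (p, k, u) => inr (tree_map (atom_map h j) p, j k, tree_map (atom_map h j) u)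
  end.

(** Edges depend on the labels only through equality of trees and the comparison of leaves. *)
Lemma sg_edge_map (W W' : countType) (h : W -> W') (j : int -> int) (t : rel W) (t' : rel W') :
  injective h -> injective j -> (forall x y, t' (h x) (h y) = t x y) ->
  {mono j : k l / (k < l)%R} ->
  forall v w, sg_edge t' (vertex_map h j v) (vertex_map h j w) = sg_edge t v w.
Proof.
move=> h_inj j_inj tE jE.
have am_inj : injective (atom_map h j).
  by move=> [x|k] [y|l] //= []; [move/h_inj->|move/j_inj->].
have tm_inj := tree_map_inj am_inj.
have partE v : part (vertex_map h j v) = tree_map (atom_map h j) (part v).
  by case: v => [w|[[p k] u]].
have codeE v : vcode (vertex_map h j v) = tree_map (atom_map h j) (vcode v).
  by case: v => [w|[[p k] u]].
have listE v : listed (vertex_map h j v) = map (tree_map (atom_map h j)) (listed v).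
  by case: v => [w|[[p k] u]] //=; exact: children_map.
have halfE q v : half (tree_map (atom_map h j) q) (vertex_map h j v) = half q v.
  by rewrite /half codeE listE children_map !mem_map.
move=> v w; rewrite /sg_edge !partE !halfE (inj_eq tm_inj).
by rewrite (tree_lt_map (r := atom_lt t)) // => -[x|k] [y|l] /=.
Qed.

Lemma vertex_map_comp (W : countType) (h h' : W -> W) (j j' : int -> int) v :
  vertex_map h j (vertex_map h' j' v) = vertex_map (h \o h') (j \o j') v.
Proof.
case: v => [w|[[p k] u]] //=.
by rewrite !tree_map_comp; congr (inr (_, _, _)); apply: eq_tree_map => -[].
Qed.

Lemma vertex_map_id (W : countType) (h : W -> W) (j : int -> int) v :
  h =1 id -> j =1 id -> vertex_map h j v = v.
Proof.
move=> hE jE; case: v => [w|[[p k] u]] /=; rewrite ?hE ?jE //.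
by rewrite !tree_map_id // => -[x|l] /=; rewrite ?hE ?jE.
Qed.

(** * Tournaments reduce to conjugacy *)

Definition shift (W : countType) : vertex W -> vertex W := vertex_map id (fun k => (k + 1)%R).
Definition unshift (W : countType) : vertex W -> vertex W := vertex_map id (fun k => (k - 1)%R).

Lemma shiftK (W : countType) : cancel (@shift W) (@unshift W).
Proof.
move=> v; rewrite /shift /unshift vertex_map_comp vertex_map_id // => k /=.
by rewrite GRing.addrK.
Qed.

Lemma unshiftK (W : countType) : cancel (@unshift W) (@shift W).
Proof.
move=> v; rewrite /shift /unshift vertex_map_comp vertex_map_id // => k /=.
by rewrite GRing.subrK.
Qed.

Lemma sg_edge_shift (W : countType) (t : rel W) v w :
  sg_edge t (shift v) (shift w) = sg_edge t v w.
Proof.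
apply: sg_edge_map => //; first exact: GRing.addIr.
by move=> k l; rewrite Num.Theory.ltrD2r.
Qed.

(** An unnamed vertex carries an integer [k] even when its trees have no integer leaf, and [k]
    moves. *)
Lemma shift_fixed (W : countType) (v : vertex W) : shift v = v <-> exists w, v = inl w.
Proof.
split=> [|[w ->] //]; case: v => [w _|[[p k] u]]; first by exists w.
move=> [_ /eqP + _].
by rewrite -{2}(GRing.addr0 k) (inj_eq (@GRing.addrI _ k)).
Qed.

Lemma partial_iso_limit (A B : eqType) (e1 : A -> A -> bool) (e2 : B -> B -> bool) (g : A -> B) :
  (forall l : seq A, exists s, partial_iso e1 e2 s /\ {in l, forall a, (a, g a) \in s}) ->
  forall a b, e1 a b = e2 (g a) (g b).
Proof.
move=> gl a b; have [s [sP gs]] := gl [:: a; b].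
by have [|| _] := sP (a, g a) (b, g b); rewrite ?gs // !inE eqxx ?orbT.
Qed.

(** Stated for any Borel family of tournaments, so that linear orders and coded structures are both
    instances. The automorphism attached to [s] is the shift, transported by an isomorphism chosen
    in a Borel way. *)
Theorem tournament_iso_reducible (eG : nat -> nat -> bool) (S : Type) (GS : set (set S))
    (X : set S) (E : S -> S -> Prop) (W : countType) (t : S -> rel W) :
  fraisse_limit_C eG ->
  (forall x y, borel_fun GS (fun s => t s x y)) ->
  (forall s, X s -> tournament (t s)) ->
  (forall s s', X s -> X s' ->
     (E s s' <-> exists2 h : W -> W, bijective h & forall x y, t s x y = t s' (h x) (h y))) ->
  borel_reducible GS X E baire_gen (is_aut eG) (aut_conj eG).
Proof.
move=> eGP bt tP tE.
have eG_ext := fraisse_limit_extensions eGP.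
have [digr [age _]] := eGP; have [eG_cm eG_par] := age_complete_multipartite digr age.
have [|||||g [g' [bg bg' gP]]] := @borel_back_and_forth S GS X (vertex W) nat
  (inr (BLeaf (inr (Posz 0)), Posz 0, BLeaf (inr (Posz 0)))) 0
  (fun s l => partial_iso (sg_edge (t s)) eG l).
- move=> l; do 2![apply: borel_forall => ?]; do 2![apply: borel_impl => ?].
  apply: borel_and; first exact: borel_const.
  exact: (borel_sg_edge _ _ bt (eq^~ _)).
- by move=> s _ p.
- move=> s l a Xs lP; apply: eG_ext => //.
    exact: sg_edge_complete_multipartite (tP s Xs).
  exact: sg_edge_parity (tP s Xs).
- move=> s l b Xs lP.
  (* The back step is the forth step of the reversed map, with the tree digraph as target. *)
  have [a aP] := sg_edge_extensions (tP s Xs) b eG_cm eG_par (partial_iso_swap lP).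
  exists a; have := partial_iso_swap aP; rewrite /= -map_comp (eq_map (g := id)) ?map_id //.
  by case.
- by move=> s l p q _ lP pl ql; have [] := lP p q pl ql.
have gE s : X s -> forall v w, eG (g s v) (g s w) = sg_edge (t s) v w.
  by move=> /gP[_ _ /partial_iso_limit gs] v w; rewrite gs.
pose phi s n := g s (shift (g' s n)).
have shift_edge s v w : X s -> eG (g s (shift v)) (g s (shift w)) = eG (g s v) (g s w).
  by move=> Xs; rewrite !gE // sg_edge_shift.
apply: (borel_reducible_intro (f := phi)).
- move=> s Xs; have [gK g'K _] := gP s Xs; split.
    exists (fun n => g s (unshift (g' s n))) => n; rewrite /phi gK.
      by rewrite shiftK g'K.
    by rewrite unshiftK g'K.
  by move=> m n; rewrite /phi shift_edge // !g'K.
- move=> _ [n [m ->]] /=.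
  by apply: (borel_fun_bind (g := fun v s => g s (shift v)) (bg' n) _ (eq^~ m)) => v; exact: bg.
move=> s s' Xs Xs'; have [gK g'K _] := gP s Xs; have [hK h'K _] := gP s' Xs'.
rewrite tE //; split=> [[f [f' fK f'K] fE]|[al [al' [[_ alE] [alK [al'K alP]]]]]].
  (* [F] relabels [W] while the shift relabels the integers, so the two commute. *)
  pose F := vertex_map f id; pose F' := vertex_map f' id.
  have FK : cancel F F' by move=> v; rewrite /F /F' vertex_map_comp vertex_map_id.
  have F'K : cancel F' F by move=> v; rewrite /F /F' vertex_map_comp vertex_map_id.
  have Fshift v : F (shift v) = shift (F v).
    by rewrite /F /shift !vertex_map_comp.
  pose al n := g s' (F (g' s n)); pose al' n := g s (F' (g' s' n)).
  have alK : cancel al al' by move=> n; rewrite /al /al' hK FK g'K.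
  have al'K : cancel al' al by move=> n; rewrite /al /al' gK F'K h'K.
  exists al, al'; split; last first.
    split; [exact: alK|split; [exact: al'K|move=> n]].
    by rewrite /al /al' /phi !gK Fshift F'K.
  split; first by exists al'.
  move=> m n; rewrite /al gE // (@sg_edge_map _ _ _ _ (t s)) //; first by rewrite -gE // !g'K.
  exact: can_inj fK.
(* A conjugating automorphism matches fixed points, which are the named vertices. *)
have phi_fix u : X u -> forall n, phi u n = n <-> exists w, n = g u (inl w).
  move=> Xu n; have [uK u'K _] := gP u Xu; split=> [|[w ->]]; last by rewrite /phi uK.
  move=> /(congr1 (g' u)); rewrite /phi uK => /shift_fixed[w wE].
  by exists w; rewrite -wE u'K.
have al_fix w : exists x, al (g s (inl w)) = g s' (inl x).
  by apply/(phi_fix s' Xs'); rewrite -alP alK (phi_fix s Xs _).2 //; exists w.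
have al'_fix w : exists x, al' (g s' (inl w)) = g s (inl x).
  apply/(phi_fix s Xs); apply: (can_inj alK); rewrite alP al'K.
  by apply/(phi_fix s' Xs'); exists w.
have [h hP] := choice al_fix; have [h' h'P] := choice al'_fix.
exists h.
  exists h' => w.
    by have := h'P (h w); rewrite -hP alK => /(can_inj gK)[].
  by have := hP (h' w); rewrite -h'P al'K => /(can_inj hK)[].
move=> x y; rewrite -(sg_edge_inl x y (tP s Xs)) -(sg_edge_inl (h x) (h y) (tP s' Xs')).
by rewrite -!gE // -!hP alE.
Qed.

(** * A generic coloured tournament *)

(** A colour, a counter that supplies fresh points, and a list of codes of points. *)
Definition cpoint : countType := (nat * nat * seq nat)%type.
Definition color (z : cpoint) : nat := z.1.1.

(** The point of larger code decides the edge through its list, so a point can prescribe its edges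
    to the points of smaller code. *)
Definition cpoint_lt (z w : cpoint) : bool :=
  if (pickle w < pickle z)%N then pickle w \in z.2
  else (pickle z < pickle w)%N && (pickle z \notin w.2).

Lemma cpoint_lt_tournament : tournament cpoint_lt.
Proof.
rewrite /cpoint_lt; split=> [z|z w ne]; first by rewrite ltnn.
case: ltngtP => //=; first by rewrite negbK.
by move/(pcan_inj pickleK)/eqP; rewrite eq_sym (negbTE ne).
Qed.

Lemma cpoint_generic (c : nat) (F : seq cpoint) (d : pred cpoint) :
  exists z, [/\ color z = c, z \notin F & {in F, forall w, cpoint_lt z w = d w}].
Proof.
pose s := [seq pickle w | w <- F & d w].
(* Avoiding all numbers up to the largest code in [F] gives the new point a larger code, so that its
   own list decides. *)
have [|k kF] := @fresh_index _ (fun k => pickle ((c, k, s) : cpoint))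
  (iota 0 (\max_(w <- F) pickle w).+1).
  by move=> k l /(pcan_inj pickleK)[].
have lt_k w : w \in F -> (pickle w < pickle ((c, k, s) : cpoint))%N.
  move=> wF; have := leq_bigmax_seq (F := pickle) w wF isT.
  by move: kF; rewrite mem_iota /= add0n -leqNgt => kF /leq_ltn_trans; apply.
exists (c, k, s); split=> //.
  by apply/negP => /lt_k; rewrite ltnn.
move=> w wF; rewrite /cpoint_lt lt_k //=; apply/mapP/idP => [[v]|dw].
  by rewrite mem_filter => /andP[dv _] /(pcan_inj pickleK)->.
by exists w => //; rewrite mem_filter dw.
Qed.

Definition color_iso (h : nat -> nat) (s : seq (cpoint * cpoint)) : Prop :=
  partial_iso cpoint_lt cpoint_lt s /\ forall p, p \in s -> color p.2 = h (color p.1).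

Lemma color_iso_forth h s z : color_iso h s -> exists w, color_iso h ((z, w) :: s).
Proof.
move=> [sP sc]; have [/mapP[p ps ->]|zs] := boolP (z \in map fst s).
  exists p.2; split; first exact: partial_iso_mem.
  by move=> q; rewrite in_cons => /predU1P[->|/sc//]; exact: (sc p).
have [w [wc wF wlt]] := cpoint_generic (h (color z)) (map snd s)
  (fun v => has (fun p => (p.2 == v) && cpoint_lt z p.1) s).
have [irr tot] := cpoint_lt_tournament.
exists w; split; last first.
  by move=> q; rewrite in_cons => /predU1P[->//|/sc].
apply: partial_iso_cons => //; first by rewrite !(negbTE (irr _)).
move=> p ps.
have zp : z != p.1 by apply: contraNneq zs => ->; exact: map_f.
have wp : w != p.2 by apply: contraNneq wF => ->; exact: map_f.
have E : cpoint_lt z p.1 = cpoint_lt w p.2.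
  rewrite wlt ?map_f //; apply/idP/hasP => [zp1|[q qs /andP[/eqP qp]]].
    by exists p; rewrite // eqxx.
  by have [+ _] := sP q p qs ps; rewrite qp eqxx => /eqP->.
by rewrite (negbTE zp) (negbTE wp) E; split=> //; rewrite (tot p.1 z) 1?(tot p.2 w) 1?eq_sym // E.
Qed.

Lemma color_iso_swap h h' s : cancel h h' -> color_iso h s ->
  color_iso h' [seq (p.2, p.1) | p <- s].
Proof.
move=> hK [sP sc]; split; first exact: partial_iso_swap.
by move=> _ /mapP[p ps ->] /=; rewrite sc.
Qed.

Lemma permutation_lift (h : nat -> nat) : bijective h ->
  exists2 g : cpoint -> cpoint, bijective g &
    (forall z w, cpoint_lt z w = cpoint_lt (g z) (g w)) /\ forall z, color (g z) = h (color z).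
Proof.
move=> [h' hK h'K].
have [|||| g g_bij gP] := @back_and_forth cpoint cpoint (0, 0, [::]) (0, 0, [::]) (color_iso h).
- by split.
- by move=> s z; exact: color_iso_forth.
- move=> s w /(color_iso_swap hK)/(color_iso_forth w)[z /(color_iso_swap h'K)].
  rewrite /= -map_comp (eq_map (g := id)) ?map_id; first by exists z.
  by case.
- by move=> s p q [sP _] ps qs; have [] := sP p q ps qs.
exists g => //; split.
  apply: partial_iso_limit => l; have [s [[sP _] sl]] := gP l.
  by exists s.
move=> z; have [s [[_ sc] sl]] := gP [:: z].
by apply: (sc (z, g z)); apply: sl; exact: mem_head.
Qed.

(** * Labelled trees as tournaments *)

Fixpoint seq_lt (s t : seq cpoint) : bool :=
  match s, t with
  | z :: s', w :: t' => if z == w then seq_lt s' t' else cpoint_lt z w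
  | [::], _ :: _ => true
  | _, [::] => false
  end.

Lemma seq_lt_tournament : tournament seq_lt.
Proof.
have [_ tot] := cpoint_lt_tournament.
split; first by elim=> //= z s IHs; rewrite eqxx.
elim=> [|z s IHs] [|w t] //=; rewrite eqseq_cons (eq_sym w).
by case: eqVneq => //= [_|zw _]; [exact: IHs|exact: tot].
Qed.

Lemma seq_lt_neq s t : seq_lt s t -> s != t.
Proof. by apply: contraTneq => ->; have [irr _] := seq_lt_tournament. Qed.

Lemma seq_lt_cat s t : t != [::] -> seq_lt s (s ++ t).
Proof. by move=> t0; elim: s => [|z s IHs] /=; [case: t t0|rewrite eqxx]. Qed.

(** A child of [s] lies in between: any child if [s] and [t] have split, and one whose last point
    precedes the next point of [t] if [s] is a prefix. *)
Lemma seq_lt_dense s t : seq_lt s t -> exists2 u, seq_lt s u & seq_lt u t.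
Proof.
move=> st; suff [z zt] : exists z, seq_lt (rcons s z) t.
  by exists (rcons s z) => //; rewrite -cats1 seq_lt_cat.
elim: s t st => [|x s IHs] [|y t] //=.
  move=> _; have [z [_ zy /(_ y (mem_head _ _)) zlt]] := cpoint_generic 0 [:: y] predT.
  by exists z; rewrite zlt; case: eqVneq zy => // ->; rewrite mem_head.
by case: eqVneq => _; [exact: IHs|exists x].
Qed.

(* Recovers the prefix order of the tree from the lexicographic order and the lengths. *)
Lemma prefix_seq_lt s t : (prefix s t && (s != t)) <->
  (seq_lt s t /\ forall u, (size u <= size s)%N -> seq_lt s u -> ~~ ((u == t) || seq_lt u t)).
Proof.
split=> [/andP[/prefixP[r ->]]|].
  case: r => [|z r _]; first by rewrite cats0 eqxx.
  split; first exact: seq_lt_cat.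
  move=> u us su; apply/norP; split.
    by apply: contraTneq us => ->; rewrite size_cat /= -ltnNge; lia.
  (* Being no longer than [s], such a [u] splits from [s] at some point, and so compares with the
     extension as it does with [s]. *)
  elim: s u us su => [|x s IHs] [|y u] //=; rewrite ltnS.
  rewrite (eq_sym y); case: eqVneq => [_|xy _] //; first exact: IHs.
  by rewrite cpoint_lt_tournament.2 ?negbK // eq_sym.
move=> [st nu]; rewrite seq_lt_neq // andbT.
apply: contrapT => /negP npre.
(* The witness is the prefix of [t] up to and including the first point where it leaves [s]. *)
suff [u us /andP[su ut]] : exists2 u, (size u <= size s)%N &
    seq_lt s u && ((u == t) || seq_lt u t) by have := nu u us su; rewrite ut.
elim: s t st npre {nu} => [|x s IHs] [|y t] //=.
case: (eqVneq x y) => [->|xy] /= st.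
  move=> /(IHs t st)[u us uP]; exists (y :: u) => //=.
  by rewrite eqseq_cons !eqxx.
by move=> _; exists [:: y] => //=; rewrite (negbTE xy) st eqseq_cons !eqxx /=; case: (t).
Qed.

(* The order [c + 1 + omega^*] on [nat]. *)
Definition block_lt (c i j : nat) : bool :=
  if (i <= c)%N then (i < j)%N else (c < j)%N && (j < i)%N.

Definition node : countType := (seq cpoint * nat)%type.

Definition node_lt (c : seq cpoint -> nat) (x y : node) : bool :=
  if x.1 == y.1 then block_lt (c x.1) x.2 y.2 else seq_lt x.1 y.1.

Lemma node_lt_tournament c : tournament (node_lt c).
Proof.
rewrite /node_lt /block_lt; split=> [x|[s i] [t j] /= ne].
  by rewrite eqxx !ltnn andbF; case: ifP.
move: ne; rewrite xpair_eqE (eq_sym t); case: eqVneq => [->|st _] /=; last exact: seq_lt_tournament.2.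
by case: (leqP i (c t)); case: (leqP j (c t)); lia.
Qed.

(** * Recovering nodes and labels from covers *)

Definition covers {T : Type} (r : T -> T -> bool) (x y : T) : Prop :=
  r x y /\ forall z, ~~ (r x z && r z y).

Section Blocks.
Variable c : seq cpoint -> nat.
Notation lt := (node_lt c).

(** By density, a whole block lies between two different blocks. *)
Lemma covers_node x y : covers lt x y -> x.1 = y.1.
Proof.
move=> [xy nxy]; apply/eqP; apply: contrapT => /negP/negbTE ne.
move: xy; rewrite /node_lt ne => /seq_lt_dense[u xu uy].
have := nxy (u, 0); rewrite /node_lt /= (negbTE (seq_lt_neq xu)).
by rewrite (negbTE (seq_lt_neq uy)) xu uy.
Qed.

Lemma covers_block s i j : block_lt (c s) i j ->
  (forall k, ~~ (block_lt (c s) i k && block_lt (c s) k j)) -> covers lt (s, i) (s, j).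
Proof.
move=> ij nij; split; first by rewrite /node_lt eqxx.
move=> [u k]; rewrite /node_lt /= (eq_sym u); case: eqVneq => [<-|su]; first exact: nij.
by rewrite (seq_lt_tournament.2 u) 1?eq_sym // andbN.
Qed.

Lemma covers_succ s i : (i < c s)%N -> covers lt (s, i) (s, i.+1).
Proof.
move=> ic; apply: covers_block => [|k]; rewrite /block_lt; first by rewrite ltnW.
by rewrite ltnW //; case: (leqP k (c s)); lia.
Qed.

(** The chain stops at [c s]: a later element of the block is some [j] beyond [c s], and [j.+1] lies
    in between. *)
Lemma covers_inv s i y : covers lt (s, i) y -> (i <= c s)%N ->
  (i < c s)%N /\ y = (s, i.+1).
Proof.
case: y => [t j] cov ic; have /= st := covers_node cov; subst t.
case: cov; rewrite /node_lt eqxx /= /block_lt ic => ij nij.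
have ic' : (i < c s)%N.
  rewrite ltnNge; apply/negP => ci; have := nij (s, j.+1).
  by rewrite /= eqxx; case: (leqP j.+1 (c s)); lia.
split=> //; congr pair; have := nij (s, i.+1); rewrite /= eqxx ic'.
lia.
Qed.

Lemma covered_start s y : ~ covers lt y (s, 0).
Proof.
case: y => t i cov; have /= ts := covers_node cov; subst t; case: cov => + _.
by rewrite /node_lt eqxx /= /block_lt !ltn0; case: ifP.
Qed.

(** Below [i.+1] comes [i] in the initial chain and [i.+2] in the descending tail. With
    [covered_start] this singles out index 0. *)
Lemma covered_succ s i : exists y, covers lt y (s, i.+1).
Proof.
have [ic|ci] := ltnP i (c s); first by exists (s, i); exact: covers_succ.
exists (s, i.+2); apply: covers_block => [|k]; rewrite /block_lt.
  by case: (leqP i.+2 (c s)); lia.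
by case: (leqP i.+2 (c s)); case: (leqP k (c s)); lia.
Qed.

End Blocks.

Section NodeIso.
Variables (c c' : seq cpoint -> nat) (F F' : node -> node).
Hypothesis F'K : cancel F' F.
Hypothesis FE : forall x y, node_lt c x y = node_lt c' (F x) (F y).

Lemma iso_covers x y : covers (node_lt c) x y <-> covers (node_lt c') (F x) (F y).
Proof.
rewrite /covers -FE; split=> -[xy nxy]; split=> // z; last by rewrite !FE.
by rewrite -(F'K z) -!FE.
Qed.

Lemma iso_start s : F (s, 0) = ((F (s, 0)).1, 0).
Proof.
case E : (F (s, 0)) => [t [|i]] //=; have [y] := covered_succ c' t i.
by rewrite -E -(F'K y) -iso_covers => /covered_start.
Qed.

Lemma iso_block s i : (i <= c s)%N ->
  (i <= c' (F (s, 0)).1)%N /\ F (s, i) = ((F (s, 0)).1, i).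
Proof.
elim: i => [|i IHi] ic; first by split=> //; exact: iso_start.
have [ic' Fi] := IHi (ltnW ic).
by have := covers_succ ic; rewrite iso_covers Fi => /covers_inv/(_ ic').
Qed.

Lemma iso_label_le s : (c s <= c' (F (s, 0)).1)%N.
Proof. by have [] := iso_block (leqnn (c s)). Qed.

End NodeIso.

(** Starts of blocks go to starts of blocks, which gives [f]. Initial chains embed in both
    directions, hence labels agree. *)
Lemma node_iso (c c' : seq cpoint -> nat) (F : node -> node) :
  bijective F -> (forall x y, node_lt c x y = node_lt c' (F x) (F y)) ->
  exists f f', [/\ cancel f f', cancel f' f, forall s, c s = c' (f s) &
    forall s t, seq_lt s t = seq_lt (f s) (f t)].
Proof.
move=> [F' FK F'K] FE.
have F'E x y : node_lt c' x y = node_lt c (F' x) (F' y) by rewrite FE !F'K.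
pose f s := (F (s, 0)).1; pose f' s := (F' (s, 0)).1.
have fE s : F (s, 0) = (f s, 0) by exact: (iso_start F'K FE).
have f'E s : F' (s, 0) = (f' s, 0) by exact: (iso_start FK F'E).
have fK : cancel f f' by move=> s; have := f'E (f s); rewrite -fE FK => -[].
have f'K : cancel f' f by move=> s; have := fE (f' s); rewrite -f'E F'K => -[].
exists f, f'; split=> // [s|s t].
  apply/eqP; rewrite eqn_leq (iso_label_le F'K FE) /=.
  by have := iso_label_le FK F'E (f s); rewrite -/(f' _) fK.
have := FE (s, 0) (t, 0); rewrite !fE /node_lt /= (inj_eq (can_inj fK)).
case: eqVneq => // -> _; have [irr _] := seq_lt_tournament.
by rewrite !(negbTE (irr _)).
Qed.

(** By [prefix_seq_lt], prefixes are expressed through [seq_lt] and lengths, both of which [f]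
    preserves. *)
Lemma iso_child (f f' : seq cpoint -> seq cpoint) : cancel f f' -> cancel f' f ->
  (forall s, size (f s) = size s) -> (forall s t, seq_lt s t = seq_lt (f s) (f t)) ->
  forall s z, exists w, f (rcons s z) = rcons (f s) w.
Proof.
move=> fK f'K fsz fE s z.
have /prefix_seq_lt[lt_s ns] : prefix s (rcons s z) && (s != rcons s z).
  rewrite prefix_rcons /=; apply/eqP => /(congr1 size); rewrite size_rcons; lia.
have /andP[/prefixP[r fr] _] : prefix (f s) (f (rcons s z)) && (f s != f (rcons s z)).
  apply/prefix_seq_lt; split=> [|u]; first by rewrite -fE.
  rewrite -(f'K u) -!fE (inj_eq (can_inj fK)) !fsz; exact: ns.
have := fsz (rcons s z); rewrite fr size_cat fsz size_rcons -addn1 => /addnI.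
by case: r fr => [|w []] // _ _; exists w; rewrite cats1.
Qed.

(** * Countable structures as labelled trees *)

Section Diagram.
Context {I : countType} {ar : I -> nat}.
Implicit Types M N : structure ar.

(* The quantifier-free type of [u 0, ..., u (n - 1)] in equality and the first [n] symbols. *)
Definition diagram M (n : nat) (u : nat -> nat) : nat * seq bool * seq (seq bool) :=
  (n, [seq u p.1 == u p.2 | p : 'I_n * 'I_n],
   [seq (if unpickle i is Some j then
           [seq M j (map_tuple (fun k : 'I_n => u k) p) | p : (ar j).-tuple 'I_n]
         else [::]) | i <- iota 0 n]).

Lemma diagram_eq M N n n' u u' : diagram M n u = diagram N n' u' ->
  [/\ n = n', forall a b, (a < n)%N -> (b < n)%N -> (u a == u b) = (u' a == u' b) &
    forall (j : I) (p : (ar j).-tuple 'I_n), (pickle j < n)%N ->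
      M j (map_tuple (fun k : 'I_n => u k) p) = N j (map_tuple (fun k : 'I_n => u' k) p)].
Proof.
case=> nn'; subst n' => /eq_in_map E1 /eq_in_map E2; split=> // [a b an bn|j p jn].
  exact: (E1 (Ordinal an, Ordinal bn) (mem_enum _ _)).
have := E2 (pickle j); rewrite mem_iota jn pickleK => /(_ isT)/eq_in_map; apply.
exact: mem_enum.
Qed.

Lemma diagram_iso M N n u (h : nat -> nat) : injective h ->
  (forall i t, M i t = N i (map_tuple h t)) ->
  diagram M n u = diagram N n (h \o u).
Proof.
move=> h_inj hE; congr (_, _, _).
  by apply: eq_map => p /=; rewrite (inj_eq h_inj).
apply: eq_map => i; case: (unpickle i) => // j; apply: eq_map => p.
by rewrite hE; congr (N j _); apply: val_inj; rewrite /= -map_comp.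
Qed.

Lemma eq_diagram M n u u' : (forall k, (k < n)%N -> u k = u' k) ->
  diagram M n u = diagram M n u'.
Proof.
move=> uu'; congr (_, _, _).
  by apply: eq_map => p /=; rewrite !uu'.
apply: eq_map => i; case: (unpickle i) => // j; apply: eq_map => p.
by congr (M j _); apply: val_inj; apply: eq_map => k; exact: uu'.
Qed.

Lemma borel_diagram n u : borel_fun (@mod_gen I ar) (fun M => diagram M n u).
Proof.
apply: (borel_fun_comp (pair (n, [seq u p.1 == u p.2 | p : 'I_n * 'I_n]))).
apply: (borel_fun_map (f := fun i M => _)) => i.
case: (unpickle i) => [j|]; last exact: borel_fun_const.
apply: (borel_fun_map (f := fun p M => _)) => p.
apply: borel_fun_bool; apply: sub_gen_smallest.
by exists j, (map_tuple (fun k : 'I_n => u k) p).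
Qed.

Definition entry (s : seq cpoint) (k : nat) : nat := color (nth (0, 0, [::]) s k).

Definition label M (s : seq cpoint) : nat := pickle (diagram M (size s) (entry s)).

Definition structure_tournament M : rel node := node_lt (label M).

Lemma borel_structure_tournament x y :
  borel_fun (@mod_gen I ar) (fun M => structure_tournament M x y).
Proof.
rewrite /structure_tournament /node_lt /label; case: eqP => _; last exact: borel_fun_const.
exact: (borel_fun_comp (fun d => block_lt (pickle d) x.2 y.2) (borel_diagram _ _)).
Qed.

(** The permutation lifts to the coloured points and acts letter by letter on sequences; labels see
    only the colours. *)
Lemma structure_tournament_iso M N : iso_struct M N ->
  exists2 F : node -> node, bijective F &
    forall x y, structure_tournament M x y = structure_tournament N (F x) (F y).
Proof.
move=> [h [h_bij hE]]; have [g [g' gK g'K] [gE gc]] := permutation_lift h_bij.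
exists (fun x => (map g x.1, x.2)).
  by exists (fun x => (map g' x.1, x.2)) => -[s i] /=; rewrite mapK.
move=> [s i] [t j]; rewrite /structure_tournament /node_lt /=.
rewrite (inj_eq (inj_map (can_inj gK))); case: eqVneq => [_|_].
  congr (block_lt (pickle _) _ _).
  rewrite size_map (diagram_iso _ _ (bij_inj h_bij) hE); apply: eq_diagram => k ks.
  by rewrite /entry (nth_map (0, 0, [::])) // gc.
elim: s t => [|z s IHs] [|w t] //=.
by rewrite (inj_eq (can_inj gK)) IHs -gE.
Qed.

Section Recover.
Variables (M N : structure ar) (f f' : seq cpoint -> seq cpoint).
Hypotheses (fK : cancel f f') (f'K : cancel f' f).
Hypothesis f_label : forall s, label M s = label N (f s).
Hypothesis f_lt : forall s t, seq_lt s t = seq_lt (f s) (f t).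

Let f_diagram s : diagram M (size s) (entry s) = diagram N (size (f s)) (entry (f s)).
Proof. exact: (pcan_inj pickleK (f_label s)). Qed.

Let f_size s : size (f s) = size s.
Proof. by have [] := diagram_eq (f_diagram s). Qed.

Let f_child s z : exists w, f (rcons s z) = rcons (f s) w.
Proof. exact: (iso_child fK f'K f_size f_lt). Qed.

Let f'_child s z : exists w, f' (rcons s z) = rcons (f' s) w.
Proof.
apply: (iso_child f'K fK) => [u|u v]; first by rewrite -f_size f'K.
by rewrite [RHS]f_lt !f'K.
Qed.

(* A finite partial map is read off a node of the first tree and its image. *)
Definition along_branch (l : seq (nat * nat)) : Prop :=
  exists s, rev l = zip (map color s) (map color (f s)).

Let size_zip_branch s : size (zip (map color s) (map color (f s))) = size s.
Proof. by rewrite size1_zip size_map // size_map f_size. Qed.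

Lemma along_branch_entry l s p : rev l = zip (map color s) (map color (f s)) -> p \in l ->
  exists2 k, (k < size s)%N & p = (entry s k, entry (f s) k).
Proof.
move=> ls; rewrite -mem_rev ls => /(nthP (0, 0))[k ks <-].
rewrite size_zip_branch in ks; exists k => //.
by rewrite nth_zip ?size_map ?f_size // !(nth_map (0, 0, [::])) ?f_size.
Qed.

(** Pairs enter [l] at the front while the branch grows at its end, hence the [rev]. *)
Lemma along_branch_cons l s a b z w : rev l = zip (map color s) (map color (f s)) ->
  f (rcons s z) = rcons (f s) w -> color z = a -> color w = b ->
  along_branch ((a, b) :: l).
Proof.
move=> ls fz <- <-; exists (rcons s z).
by rewrite rev_cons ls fz !map_rcons zip_rcons // !size_map f_size.
Qed.

(** Every number is the colour of some child of any node, so a branch and its image can be prolonged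
    from either side. Equal diagrams make the limit injective and compatible with the symbols. *)
Lemma structure_iso_of_tree_iso : iso_struct M N.
Proof.
have [|||| h h_bij hl] := @back_and_forth nat nat 0 0 along_branch.
- by exists [::]; have := f_size [::]; case: (f [::]).
- move=> l a [s ls]; have [w fw] := f_child s ((a, 0, [::]) : cpoint).
  by exists (color w); exact: along_branch_cons fw _ _.
- move=> l b [s ls]; have [z fz] := f'_child (f s) ((b, 0, [::]) : cpoint).
  exists (color z); apply: (along_branch_cons (w := (b, 0, [::])) ls _ erefl) => //.
  by rewrite -[in LHS](fK s) -fz f'K.
- move=> l p q [s ls] /(along_branch_entry ls)[k ks ->] /(along_branch_entry ls)[m ms ->].
  by have [_ + _] := diagram_eq (f_diagram s); apply.
exists h; split=> // j t.
(* The numbers up to [pickle j] make the branch long enough for its diagram to contain the symbol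
   [j]. *)
have [l [[s ls] lP]] := hl (t ++ iota 0 (pickle j).+1).
have js : (pickle j < size s)%N.
  rewrite -(size_zip_branch s) -ls size_rev.
  rewrite -[X in (X <= _)%N](size_iota 0) -(size_map (fun a => (a, h a))).
  apply: uniq_leq_size; first by rewrite map_inj_uniq ?iota_uniq // => a b [].
  by move=> _ /mapP[a aj ->]; apply: lP; rewrite mem_cat aj orbT.
(* A position of [a] on the branch; by [posP] the default is not met for entries of [t]. *)
pose pos a := odflt (Ordinal js)
  [pick k : 'I_(size s) | (entry s k == a) && (entry (f s) k == h a)].
have posP a : a \in t -> entry s (pos a) = a /\ entry (f s) (pos a) = h a.
  move=> at_; rewrite /pos; case: pickP => [k /andP[/eqP-> /eqP->] //|no].
  have [|k ks [ak hk]] := @along_branch_entry l s (a, h a) ls.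
    by apply: lP; rewrite mem_cat at_.
  by have := no (Ordinal ks); rewrite /= -ak -hk !eqxx.
have [_ _ /(_ j (map_tuple pos t) js)] := diagram_eq (f_diagram s).
set p1 := map_tuple _ _; set p2 := map_tuple _ (map_tuple pos t).
have -> : p1 = t.
  apply: val_inj; rewrite /= -map_comp -[RHS]map_id.
  by apply/eq_in_map => a /posP[].
have -> // : p2 = map_tuple h t.
by apply: val_inj; rewrite /= -map_comp; apply/eq_in_map => a /posP[].
Qed.

End Recover.

Lemma structure_tournamentP M N : iso_struct M N <->
  exists2 F : node -> node, bijective F &
    forall x y, structure_tournament M x y = structure_tournament N (F x) (F y).
Proof.
split; first exact: structure_tournament_iso.
case=> F F_bij /(node_iso F_bij)[f [f' [fK f'K fl flt]]].
exact: structure_iso_of_tree_iso fK f'K fl flt.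
Qed.

End Diagram.

(** * Conjugacy as isomorphism of structures, and Borel completeness *)

Lemma is_class_setT (I : countType) (ar : I -> nat) : is_class [set: structure ar].
Proof. by split=> //; exact: (@borel_const _ (@mod_gen I ar) True). Qed.

(** Code [phi] by the edge relation and the graph of [phi]: isomorphisms of such structures are the
    automorphisms of [eG] that conjugate. *)
Lemma conjugacy_reducible_structures (eG : nat -> nat -> bool) :
  borel_reducible baire_gen (is_aut eG) (aut_conj eG)
    (@mod_gen bool (fun=> 2)) setT (@iso_struct bool (fun=> 2)).
Proof.
pose st (phi : nat -> nat) : structure (fun _ : bool => 2) := fun i t =>
  if i then eG (tnth t ord0) (tnth t ord_max) else phi (tnth t ord0) == tnth t ord_max.
have stE i phi a b : st phi i [tuple a; b] = if i then eG a b else phi a == b.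
  by rewrite /st; case: i.
have pairE (t : 2.-tuple nat) : t = [tuple tnth t ord0; tnth t ord_max].
  apply: eq_from_tnth => k; case: (unliftP ord0 k) => [k'|] ->; last by [].
  by rewrite (ord1 k'); congr tnth; apply: val_inj.
apply: (borel_reducible_intro (f := st)) => //.
  move=> _ [i [t ->]] /=; rewrite /st; case: i t => t; first exact: borel_const.
  apply: (borel_ext (P := fun phi => phi (tnth t ord0) = tnth t ord_max)).
    by move=> phi; split=> [->//|/eqP].
  by apply: sub_gen_smallest; exists (tnth t ord0), (tnth t ord_max).
move=> phi psi _ _; split=> [[al [al' [[al_bij alE] [alK [al'K alP]]]]]|[h [h_bij hE]]].
  exists al; split=> // i t; rewrite (pairE t) stE.
  have -> : map_tuple al [tuple tnth t ord0; tnth t ord_max] =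
      [tuple al (tnth t ord0); al (tnth t ord_max)] by apply: val_inj.
  rewrite stE; case: i t => t; first by rewrite alE.
  by rewrite -alP alK (inj_eq (can_inj alK)).
have h2 i a b : st phi i [tuple a; b] = st psi i [tuple h a; h b].
  by rewrite hE; congr (st psi i _); apply: val_inj.
have [h' hK h'K] := h_bij; exists h, h'; split; last split=> //.
  by split=> // x y; have := h2 true x y; rewrite !stE.
split=> // x; apply/esym/eqP; have := h2 false (h' x) (phi (h' x)).
by rewrite !stE eqxx h'K => <-.
Qed.

Theorem theorem4p2 (eG : nat -> nat -> bool) :
  fraisse_limit_C eG ->
  borel_reducible rel_gen is_LO iso_LO baire_gen (is_aut eG) (aut_conj eG) /\
  borel_complete baire_gen (is_aut eG) (aut_conj eG).
Proof.
move=> eGP; split; last split.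
- apply: (tournament_iso_reducible (W := nat) (t := fun R => R) eGP).
  + move=> x y; apply: borel_fun_bool; apply: sub_gen_smallest.
    by exists x, y.
  + move=> R [irr [tr tot]]; split=> // x y /eqP/tot.
    case Rxy : (R x y); case Ryx : (R y x) => // _.
    by have := irr x; rewrite (tr x y x Rxy Ryx).
  + by move=> R R' _ _; split=> [[h [? ?]]|[h ? ?]]; exists h.
- exists bool, (fun=> 2), setT; split; first exact: is_class_setT.
  exact: conjugacy_reducible_structures.
- move=> I ar K _.
  apply: (tournament_iso_reducible (t := @structure_tournament I ar) eGP).
  + exact: borel_structure_tournament.
  + by move=> M _; exact: node_lt_tournament.
  + by move=> M N _ _; exact: structure_tournamentP.
Qed.
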